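(* Let $n \ge 1$, let $X$ be an $n$-element set, and suppose $\mathcal{F}$ is a family of subsets of $X$ that contains no $3$-simplex. Then \[|\mathcal{F}| \le 2^{n-1} + \binom{n-1}{0} + \binom{n-1}{1} + \binom{n-1}{2},\] with equality if and only if $\mathcal{F} = \{A \subseteq X : x \in A\} \cup \{A \subseteq X\setminus\{x\} : |A| \le 2\}$ for some $x \in X$.
   Context: For $d \ge 1$, a $d$-simplex is a collection of $d+1$ sets $A_1,\ldots,A_{d+1}$ such that $\bigcap_{i=1}^{d+1} A_i = \emptyset$ but $\bigcap_{i \ne j} A_i \ne \emptyset$ for every $1 \le j \le d+1$. A family $\mathcal{F}$ contains a $d$-simplex if some $d+1$ of its members form a $d$-simplex; otherwise it is $d$-simplex-free. *)

(* Defs.v *)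
From mathcomp Require Import all_boot.

Set Implicit Arguments.
Unset Strict Implicit.
Unset Printing Implicit Defensive.

(* Meant for d >= 1. Distinctness of the A i is not required separately: for
   d >= 1 it is forced, since A i = A j with i != j would make the (nonempty)
   intersection omitting i equal to the (empty) full intersection. *)
Definition is_simplex (T : finType) (d : nat) (A : 'I_d.+1 -> {set T}) : Prop :=
  \bigcap_i A i = set0 /\ forall j, \bigcap_(i | i != j) A i <> set0.

Definition contains_simplex (T : finType) (d : nat) (F : {set {set T}}) : Prop :=
  exists A : 'I_d.+1 -> {set T}, (forall i, A i \in F) /\ is_simplex A.

Definition simplex_free (T : finType) (d : nat) (F : {set {set T}}) : Prop :=
  ~ contains_simplex d F.

(* Main.v *)
(** Let B be a largest member of F other than the ground set S, and cut F along
    the traces E of its members on S \ B.  If B, A1, ..., Ad are such that the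
    Ai have the same nonempty trace E outside B, then a (d-1)-simplex formed by
    the A_i :&: B would give a d-simplex of F together with B; so every slice
    with E nonempty contains no (d-1)-simplex, while the slice E = set0 is
    handled by induction on |S|.  Maximality of B moreover bounds the sizes in
    the slice of E by |B| - |E|, and families of small sets without a
    (d-1)-simplex obey better bounds.  For d = 2 and d = 3 the sum of these
    bounds is the claimed one, and it is attained only when |S \ B| = 1. *)
Require Import Defs.
From mathcomp Require Import all_boot zify.

Set Implicit Arguments.
Unset Strict Implicit.
Unset Printing Implicit Defensive.

(** * Simplex-free families and their slices *)

Section Families.
Variable T : finType.
Implicit Types (A B C D E S : {set T}) (F G : {set {set T}}) (x y z : T).

(** [free1], [free2] and [free3] exclude a 1-, 2- and 3-simplex. Allowing repeated members costs
    nothing: if two coincide, a hypothesis already gives the conclusion. *)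
Definition free1 F :=
  forall A B, A \in F -> B \in F -> A != set0 -> B != set0 -> A :&: B != set0.

Definition free2 F :=
  forall A B C, A \in F -> B \in F -> C \in F ->
    A :&: B != set0 -> A :&: C != set0 -> B :&: C != set0 ->
    A :&: B :&: C != set0.

Definition free3 F :=
  forall A B C D, A \in F -> B \in F -> C \in F -> D \in F ->
    A :&: B :&: C != set0 -> A :&: B :&: D != set0 ->
    A :&: C :&: D != set0 -> B :&: C :&: D != set0 ->
    A :&: B :&: C :&: D != set0.

(** For [E] disjoint from [B], these are the sets [A :&: B] for the members [A] of [F] with
    [A :\: B = E]. *)
Definition slice F B E := [set C in powerset B | C :|: E \in F].

(** With [d = 2] this is the extremal family of the theorem, on a ground set that shrinks in the
    induction; [d = 1] is its analogue for [free2]. *)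
Definition star_or_small S y d :=
  [set A in powerset S | (y \in A) || (#|A| <= d)].

Lemma simplex_free_free3 F : simplex_free 3 F -> free3 F.
Proof.
move=> hF A B C D AF BF CF DF /set0Pn[w wABC] /set0Pn[z zABD].
move=> /set0Pn[y yACD] /set0Pn[x xBCD]; apply/negP => /eqP ABCD0; apply: hF.
exists (tnth [tuple A; B; C; D]); split.
  by move=> i; have := mem_tnth i [tuple A; B; C; D];
     rewrite !inE => /or4P[]/eqP->.
split; first by rewrite !big_ord_recl big_ord0 !(tnth_nth A) /= setIT !setIA.
(* The [j]-th of the points [x; y; z; w] comes from the intersection that omits the [j]-th of
   [A; B; C; D]. *)
move=> j; apply/eqP/set0Pn; exists (tnth [tuple x; y; z; w] j).
move: xBCD yACD zABD wABC; rewrite !inE.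
move=> /andP[/andP[xB xC] xD] /andP[/andP[yA yC] yD].
move=> /andP[/andP[zA zB] zD] /andP[/andP[wA wB] wC].
apply/bigcapP => i; rewrite (tnth_nth A) (tnth_nth x).
by case: i => -[|[|[|[|//]]]] ?; case: j => -[|[|[|[|//]]]] ?.
Qed.

Lemma free2_sub F G : G \subset F -> free2 F -> free2 G.
Proof. by move=> /subsetP GF hF A B C /GF ? /GF ? /GF ?; apply: hF. Qed.

Lemma free3_sub F G : G \subset F -> free3 F -> free3 G.
Proof. by move=> /subsetP GF hF A B C D /GF ? /GF ? /GF ? /GF ?; apply: hF. Qed.

Lemma slice0_sub F B : slice F B set0 \subset F.
Proof. by apply/subsetP => C; rewrite !inE setU0 => /andP[]. Qed.

Lemma slice_sub F B E : slice F B E \subset powerset B.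
Proof. by apply/subsetP => C; rewrite !inE => /andP[]. Qed.

(** The sets [B], [C :|: E] and [D :|: E] meet pairwise, in points of [C], [D] and [E]. A point
    common to all three is in [B], hence outside [E], hence in [C :&: D]. *)
Lemma slice_free1 F B E : free2 F -> B \in F -> E != set0 -> [disjoint E & B] ->
  free1 (slice F B E).
Proof.
move=> hF BF /set0Pn[e eE] dEB C D; rewrite !inE.
move=> /andP[/subsetP CB CF] /andP[/subsetP DB DF] /set0Pn[c cC] /set0Pn[d dD].
have /set0Pn[p] : B :&: (C :|: E) :&: (D :|: E) != set0.
  apply: hF => //; apply/set0Pn; first by exists c; rewrite !inE cC (CB c).
    by exists d; rewrite !inE dD (DB d).
  by exists e; rewrite !inE eE !orbT.
rewrite !inE => /andP[/andP[pB]].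
have /negPf-> : p \notin E by rewrite (disjointFl dEB).
by rewrite !orbF => pC pD; apply/set0Pn; exists p; rewrite inE pC.
Qed.

Lemma slice_free2 F B E : free3 F -> B \in F -> E != set0 -> [disjoint E & B] ->
  free2 (slice F B E).
Proof.
move=> hF BF /set0Pn[e eE] dEB C D G; rewrite !inE.
move=> /andP[/subsetP CB CF] /andP[/subsetP DB DF] /andP[/subsetP GB GF].
move=> /set0Pn[x /setIP[xC xD]] /set0Pn[y /setIP[yC yG]] /set0Pn[z /setIP[zD zG]].
have /set0Pn[p] : B :&: (C :|: E) :&: (D :|: E) :&: (G :|: E) != set0.
  apply: hF => //; apply/set0Pn.
  - by exists x; rewrite !inE xC xD (CB x).
  - by exists y; rewrite !inE yC yG (CB y).
  - by exists z; rewrite !inE zD zG (DB z).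
  - by exists e; rewrite !inE eE !orbT.
rewrite !inE => /andP[/andP[/andP[pB]]].
have /negPf-> : p \notin E by rewrite (disjointFl dEB).
by rewrite !orbF => pC pD pG; apply/set0Pn; exists p; rewrite !inE pC pD.
Qed.

Lemma card_slices F S B : F \subset powerset S -> B \subset S ->
  #|F| = \sum_(E in powerset (S :\: B)) #|slice F B E|.
Proof.
move=> /subsetP FS BS; rewrite -sum1_card.
rewrite (partition_big (fun A => A :\: B) (mem (powerset (S :\: B)))) /=; last first.
  by move=> A /FS; rewrite !inE => AS; apply: setSD.
apply: eq_bigr => E; rewrite inE => /subsetP ESB; rewrite sum1_card.
have dEB : E :&: B = set0.
  by apply/setP => x; rewrite !inE; apply/negP => /andP[/ESB];
     rewrite inE => /andP[/negP].
rewrite -(card_in_imset (f := fun C => C :|: E) (D := slice F B E)).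
  apply: eq_card => A; rewrite unfold_in; apply/andP/imsetP.
    move=> [AF /eqP EA]; exists (A :&: B); last by rewrite -EA setUC setUC setID.
    by rewrite !inE subsetIr -EA setID.
  move=> [C]; rewrite !inE => /andP[CB CEF] ->; split=> //.
  by rewrite setDUl; move/eqP: dEB; rewrite setI_eq0 => /setDidPl->;
     move: CB; rewrite -setD_eq0 => /eqP->; rewrite set0U.
move=> C D; rewrite !inE => /andP[/setIidPl CB _] /andP[/setIidPl DB _] /(congr1 (fun A => A :&: B)).
by rewrite !setIUl dEB !setU0 CB DB.
Qed.

(** Turns a correction that concerns only traces of size [k] into a binomial coefficient, so that
    bounds can be compared trace by trace. *)
Lemma card_powersetD S B k : B \subset S ->
  \sum_(E in powerset (S :\: B)) (#|E| == k : nat) = 'C(#|S| - #|B|, k).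
Proof.
move=> BS; rewrite -big_mkcondr /= sum1_card -(cardsDS BS) -cards_draws.
by apply: eq_card => E; rewrite !inE unfold_in /= inE.
Qed.

Lemma slice_card F S B E C : F \subset powerset S ->
  (forall A, A \in F -> #|A| <= #|B|) -> [disjoint E & B] ->
  C \in slice F B E -> #|C| + #|E| <= #|B|.
Proof.
move=> FS maxB dEB; rewrite !inE => /andP[CB /maxB].
have d : [disjoint C & E] by rewrite disjoint_sym; apply: disjointWr dEB.
by rewrite cardsU disjoint_setI0 // cards0 subn0.
Qed.

(** * Upper bounds in the absence of 1-simplices and of 2-simplices *)

(** A member and its complement in [S] do not meet, so [F] and the family [G] of complements are
    disjoint, equally large parts of [powerset S]. *)
Lemma intersecting_le F S : F \subset powerset S ->
  (forall A B, A \in F -> B \in F -> A :&: B != set0) -> #|F|.*2 <= 2 ^ #|S|.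
Proof.
move=> /subsetP FS hF; pose G := [set S :\: A | A in F].
have <- : #|G| + #|F| = #|F|.*2.
  rewrite card_in_imset ?addnn // => A B /FS + /FS; rewrite !inE.
  by move=> /setIidPr AS /setIidPr BS /(congr1 (setD S)); rewrite !setDDr !setDv !set0U AS BS.
rewrite -card_powerset.
have dGF : [disjoint G & F].
  apply/pred0P => C /=; apply/negP => /andP[/imsetP[A AF ->] SAF].
  have := hF _ _ AF SAF; apply/negP/negPn/eqP/setP => x; rewrite !inE.
  by case: (x \in A).
rewrite -(cardsUI G F) disjoint_setI0 // cards0 addn0.
apply/subset_leq_card; rewrite subUset; apply/andP; split; last exact/subsetP.
by apply/subsetP => C /imsetP[A _ ->]; rewrite inE subsetDl.
Qed.

(** Replacing [set0] by [S] makes the family intersecting without shrinking it, as [S] was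
    absent. *)
Lemma free1_proper_le F S s : #|S| = s.+1 -> F \subset powerset S -> free1 F ->
  S \notin F -> #|F| <= 2 ^ s.
Proof.
move=> cS FS hF SF; have S0 : S != set0 by rewrite -card_gt0 cS.
pose G := S |: (F :\ set0).
have GS : G \subset powerset S.
  rewrite subUset sub1set inE subxx /=; exact: subset_trans (subsetDl _ _) FS.
have G0 A : A \in G -> A != set0.
  by rewrite !inE => /orP[/eqP->|/andP[]].
have := @intersecting_le G S GS; rewrite cS expnS mul2n leq_double => H.
have: #|G| <= 2 ^ s.
  apply: H => A B AG BG; have [A0 B0] := (G0 _ AG, G0 _ BG).
  have [AS BS] : A \subset S /\ B \subset S.
    by split; have := subsetP GS; [move=> /(_ _ AG)|move=> /(_ _ BG)]; rewrite inE.
  move: AG BG; rewrite !inE => /orP[/eqP->|/andP[_ AF]].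
    by move=> _; rewrite (setIidPr BS).
  move=> /orP[/eqP->|/andP[_ BF]]; first by rewrite (setIidPl AS).
  exact: hF.
rewrite cardsU1 !inE (negPf SF) andbF /= => Gs.
by rewrite (cardsD1 set0); apply: leq_trans Gs; rewrite leq_add2r leq_b1.
Qed.

Lemma free1_le F S s : #|S| = s.+1 -> F \subset powerset S -> free1 F ->
  #|F| <= 2 ^ s + 1.
Proof.
move=> cS FS hF; rewrite (cardsD1 S) addnC leq_add ?leq_b1 //.
apply: (@free1_proper_le _ S) => //; last by rewrite !inE eqxx.
  exact: subset_trans (subsetDl _ _) FS.
by move=> A B /setD1P[_ AF] /setD1P[_ BF]; apply: hF.
Qed.


(* The nonempty members still intersect each other after adding s + 1 sets
   of size at least s: those containing t if [set t] is in F, and all S :\ u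
   otherwise. *)
Lemma free1_small_le F S s : #|S| = s.+1 -> F \subset powerset S -> free1 F ->
  (forall A, A \in F -> #|A| + 2 <= #|S|) -> #|F| + s <= 2 ^ s.
Proof.
move=> cS FS hF smallF; pose F0 := F :\ set0.
have FF0 : #|F| <= #|F0| + 1 by rewrite (cardsD1 set0 F) addnC leq_add2l leq_b1.
(* The sets [S :\ u] meet pairwise only if [S] has at least three points; for [s <= 1] the size
   bound leaves no nonempty member. *)
case: (leqP s 1) => [s1|s1].
  have F00 : F0 = set0.
    apply/setP => A; rewrite !inE; apply/negP => /andP[A0 /smallF].
    by move: A0; rewrite -card_gt0 cS; lia.
  rewrite F00 cards0 in FF0.
  case: s s1 cS => [|[|//]] _ cS; last by rewrite expn1; lia.
  suff -> : F = set0 by rewrite cards0.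
  by apply/setP => A; rewrite inE; apply/negP => /smallF; rewrite cS; lia.
have FA A : A \in F0 -> [/\ A \in F, A \subset S & 0 < #|A|].
  rewrite !inE -card_gt0 => /andP[? AF]; split=> //.
  by have := subsetP FS _ AF; rewrite inE.
(* Covers both choices of added sets: [W = [set t]] gives [S] and the [S :\ u] with [u != t],
   [W = set0] gives every [S :\ u]. *)
have extend W : (forall u v, u \in S -> v \in S ->
      (S :\: ([set u] :\: W)) :&: (S :\: ([set v] :\: W)) != set0) ->
    (forall u A, u \in S -> A \in F0 -> A :&: (S :\: ([set u] :\: W)) != set0) ->
    {in S &, injective (fun u => S :\: ([set u] :\: W))} -> #|F| + s <= 2 ^ s.
  move=> HH FH injH; pose H := [set S :\: ([set u] :\: W) | u in S].
  have cH : #|H| = s.+1 by rewrite card_in_imset.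
  have dFH : F0 :&: H = set0.
    apply/setP => A; rewrite inE in_set0; apply/negP => /andP[/FA[/smallF + _ _]].
    move=> + /imsetP[u uS defA]; rewrite defA.
    have : #|S :&: ([set u] :\: W)| <= 1.
      rewrite -(cards1 u); apply: subset_leq_card.
      by apply: subset_trans (subsetIr _ _) (subsetDl _ _).
    by rewrite cardsD; lia.
  suff : #|F0 :|: H|.*2 <= 2 ^ #|S|.
    by rewrite cS expnS mul2n leq_double cardsU dFH cards0 cH; lia.
  apply: intersecting_le.
    apply/subsetP => A; rewrite !inE => /orP[AF|/imsetP[u _ ->]]; last exact: subsetDl.
    by have [] := FA A; rewrite ?inE.
  move=> A B /setUP[AF|/imsetP[u uS ->]] /setUP[BF|/imsetP[v vS ->]].
  - have [[? _ ?] [? _ ?]] := (FA _ AF, FA _ BF).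
    by apply: hF => //; rewrite -card_gt0.
  - exact: FH.
  - by rewrite setIC; apply: FH.
  - exact: HH.
case: (boolP [exists t, [set t] \in F]) => [/existsP[t tF]|/existsPn noF].
  have tS : t \in S by have := subsetP FS _ tF; rewrite inE sub1set.
  apply: (extend [set t]) => [u v _ _|u A _ /FA[AF _ A0]|u v uS vS /setP e].
  - by apply/set0Pn; exists t; rewrite !inE tS eqxx.
  - have /set0Pn[x /setIP[xA]] : A :&: [set t] != set0.
      by apply: hF => //; rewrite -card_gt0 ?cards1.
    by rewrite inE => /eqP xt; apply/set0Pn; exists t; rewrite !inE tS eqxx -xt xA.
  - move: (e u) (e v); rewrite !inE uS vS !eqxx !andbT.
    by case: (eqVneq u v) => // _; case: (eqVneq u t) => [->|_];
       case: (eqVneq v t) => [->|_].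
have big u A : 1 < #|A| -> A \subset S -> A :&: (S :\: ([set u] :\: set0)) != set0.
  move=> A1 /setIidPl AS; rewrite setD0 setIDA AS -card_gt0.
  by have := cardsD1 u A; case: (u \in A) => /=; lia.
apply: (extend set0) => [u v uS vS|u A uS AF|u v uS vS].
- apply: big; last exact: subsetDl.
  by rewrite setD0; have := cardsD1 u S; rewrite uS cS; lia.
- have [AF' AS A0] := FA _ AF; apply: big => //.
  rewrite ltn_neqAle A0 andbT eq_sym; apply/negP => /cards1P[t At].
  by have := noF t; rewrite -At AF'.
- rewrite !setD0 => /setP/(_ u); rewrite !inE uS eqxx andbT /= => /esym/negbT.
  by rewrite andbT negbK => /eqP.
Qed.

(* The term m * 'C(v, 2) is what the slices with #|E| = 2 lose, their members
   having at most #|B| - 2 elements; it improves Milner's bound for families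
   without large sets. *)
Lemma free2_max_le F S B m v : F \subset powerset S -> free2 F -> S \notin F ->
  B \in F -> (forall A, A \in F -> #|A| <= #|B|) -> #|B| = m.+1 ->
  #|S| = m.+1 + v -> #|slice F B set0| <= 2 ^ m + m.+1 ->
  #|F| + m * 'C(v, 2) <= 2 ^ (m + v) + m.+1.
Proof.
move=> FS hF SF BF maxB cB cS F0.
have BS : B \subset S by have := subsetP FS _ BF; rewrite inE.
have cV : #|S| - #|B| = v by rewrite cS cB; lia.
have pw : \sum_(E in powerset (S :\: B)) 2 ^ m = 2 ^ (m + v).
  by rewrite sum_nat_const card_powerset (cardsDS BS) cV mulnC -expnD.
(* Both sides become sums over the traces [E], compared termwise: [2 ^ m] for each [E], an excess
   [m.+1] at [set0], a deficit [m] when [#|E|] is 2. *)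
rewrite (card_slices FS BS) -pw -cV -(card_powersetD _ BS) big_distrr /=.
have -> : m.+1 = m.+1 * 'C(#|S| - #|B|, 0) by rewrite bin0 muln1.
rewrite -(card_powersetD _ BS) big_distrr /= -!big_split /=.
apply: leq_sum => E; rewrite inE => /subsetDP[ES dEB].
have [->|E0] := eqVneq E set0.
  by rewrite cards0 /= muln0 muln1 addn0.
have E1 : 0 < #|E| by rewrite card_gt0.
have F1 := slice_free1 hF BF E0 dEB.
have sB := @slice_sub F B E.
have szC C : C \in slice F B E -> #|C| + #|E| <= #|B| by apply: slice_card FS _ _.
have -> : (#|E| == 0) = false by case: #|E| E1.
rewrite muln0 addn0; case: (eqVneq #|E| 2) => E2.
  rewrite muln1; apply: free1_small_le cB sB F1 _ => C /szC.
  by rewrite E2.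
rewrite muln0 addn0; apply: free1_proper_le cB sB F1 _.
by apply/negP => /szC; lia.
Qed.

(** A largest [B] is proper because [S] is not a member; the offsets in [m] and [v] encode
    [0 < #|B| < #|S|]. *)
Lemma max_member F S : F \subset powerset S -> S \notin F ->
  #|F| <= 1 \/
  exists2 B, [/\ B \in F, B \subset S & forall A, A \in F -> #|A| <= #|B|] &
  exists m v, #|B| = m.+1 /\ #|S| = m.+1 + v.+1.
Proof.
move=> /subsetP FS SF.
case: (boolP [exists A in F, A != set0]) => [/exists_inP[A0 A0F A00]|]; last first.
  move=> /exists_inPn F0; left; rewrite -(cards1 (set0 : {set T})).
  by apply/subset_leq_card/subsetP => A /F0; rewrite negbK inE.
right; case: (arg_maxnP (fun A : {set T} => #|A|) A0F) => B BF maxB.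
have BS : B \proper S.
  by rewrite properEneq; have := FS _ BF; rewrite inE => ->;
     rewrite andbT; apply: contraNneq SF => <-.
exists B; first by split=> //; apply: proper_sub.
have ltBS := proper_card BS.
have : 0 < #|B| by apply: leq_trans (maxB _ A0F); rewrite card_gt0.
by exists #|B|.-1, (#|S| - #|B|).-1; lia.
Qed.

(** Strong induction: the members inside a largest [B], with [B] itself removed, satisfy the
    hypotheses on the ground set [B]. Restoring [B] costs 1, and [m.+1 <= s] since [B] is proper. *)
Lemma free2_proper_le F S s : #|S| = s.+1 -> F \subset powerset S -> free2 F ->
  S \notin F -> #|F| <= 2 ^ s + s.
Proof.
elim/ltn_ind: s F S => s IH F S cS FS hF SF.
have [F1|[B [BF BS maxB] [m [v [cB cSv]]]]] := max_member FS SF.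
  by apply: leq_trans F1 _; have : 0 < 2 ^ s by [rewrite expn_gt0]; lia.
have sE : s = m + v.+1 by lia.
suff F0 : #|slice F B set0| <= 2 ^ m + m.+1.
  by have := free2_max_le FS hF SF BF maxB cB cSv F0; rewrite -sE; lia.
pose F' := slice F B set0 :\ B.
have : #|F'| <= 2 ^ m + m.
  apply: (IH m _ F' B) => //.
  - by rewrite sE addnS ltnS leq_addr.
  - by apply: subset_trans (slice_sub F B set0); apply: subsetDl.
  - by apply: free2_sub hF; apply: subset_trans (slice0_sub F B); apply: subsetDl.
  - by rewrite !inE eqxx.
move=> F'm; rewrite (cardsD1 B) -/F' addnC addnS.
by apply: leq_trans (leq_add F'm (leq_b1 _)) _; lia.
Qed.

Lemma free2_le F S s : #|S| = s.+1 -> F \subset powerset S -> free2 F ->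
  #|F| <= 2 ^ s + s.+1.
Proof.
move=> cS FS hF; have Fs : #|F :\ S| <= 2 ^ s + s.
  apply: (@free2_proper_le _ S) => //; last by rewrite !inE eqxx.
    exact: subset_trans (subsetDl _ _) FS.
  by apply: free2_sub hF; apply: subsetDl.
rewrite (cardsD1 S F) addnC addnS.
by apply: leq_trans (leq_add Fs (leq_b1 _)) _; lia.
Qed.

(** Once [free2_le] bounds the slice of [set0], keeping [m] and [v] explicit retains what is gained
    when the largest member is small. *)
Lemma free2_proper_max F S s : #|S| = s.+1 -> F \subset powerset S -> free2 F ->
  S \notin F -> #|F| <= 1 \/
  exists2 B, [/\ B \in F, B \subset S & forall A, A \in F -> #|A| <= #|B|] &
  exists m v, [/\ #|B| = m.+1, 0 < v, s = m + v &
    #|F| + m * 'C(v, 2) <= 2 ^ s + m.+1].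
Proof.
move=> cS FS hF SF.
have [F1|[B [BF BS maxB] [m [v [cB cSv]]]]] := max_member FS SF; first by left.
have sE : s = m + v.+1 by lia.
right; exists B => //; exists m, v.+1; split=> //.
rewrite [X in 2 ^ X]sE.
apply: (free2_max_le FS hF SF BF maxB cB cSv).
apply: free2_le cB (slice_sub _ _ _) _.
by apply: free2_sub hF; apply: slice0_sub.
Qed.

(** Here [v >= 2], so the deficit [m * 'C(v, 2)] is at least [m] and leaves 1 of the excess
    [m.+1]. *)
Lemma free2_small_le F S s : #|S| = s.+1 -> F \subset powerset S -> free2 F ->
  (forall A, A \in F -> #|A| + 2 <= #|S|) -> #|F| <= 2 ^ s + 1.
Proof.
move=> cS FS hF smallF.
have SF : S \notin F by apply/negP => /smallF; lia.
have [|[B [BF _ _] [m [v [cB v0 sE]]]]] := free2_proper_max cS FS hF SF; first by lia.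
have v2 : 2 <= v by have := smallF _ BF; rewrite cS cB; lia.
have : 0 < 'C(v, 2) by rewrite bin_gt0.
by move=> ? ?; have : m * 1 <= m * 'C(v, 2) by [rewrite leq_mul2l; lia]; lia.
Qed.

Lemma free2_smaller_le F S s : #|S| = s.+1 -> F \subset powerset S -> free2 F ->
  (forall A, A \in F -> #|A| + 3 <= #|S|) -> #|F| <= 2 ^ s.
Proof.
move=> cS FS hF smallF.
have SF : S \notin F by apply/negP => /smallF; lia.
have [|[B [BF _ maxB] [m [v [cB v0 sE]]]]] := free2_proper_max cS FS hF SF.
  by have : 0 < 2 ^ s by [rewrite expn_gt0]; lia.
have v3 : 3 <= v by have := smallF _ BF; rewrite cS cB; lia.
(* For [m = 0] the deficit vanishes, but then only [set0] and singletons occur, and [s + 2 <= 2 ^ s]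
   for [s >= 3]. Otherwise ['C(v, 2) >= 3] absorbs the whole excess. *)
case: m cB sE => [|m] cB sE.
  move=> _; have : F \subset set0 |: [set [set x] | x in S].
    apply/subsetP => A AF; have := maxB _ AF; have := subsetP FS _ AF.
    rewrite cB !inE leq_eqVlt ltnS leqn0 cards_eq0 orbC => AS /orP[->//|/cards1P[x defA]].
    by apply/orP; right; apply/imsetP; exists x => //; rewrite -sub1set -defA.
  move=> /subset_leq_card/leq_trans; apply.
  rewrite cardsU1; apply: leq_trans (leq_add (leq_b1 _) (leq_imset_card _ _)) _.
  rewrite cS sE add0n; case: v v3 {v0 sE} => [|[|[|v]]] // _.
  elim: v => // v IHv; rewrite expnS; lia.
have : 3 <= 'C(v, 2) by rewrite -[3]/('C(3, 2)); apply: leq_bin2l.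
by move=> ? ?; have : m.+1 * 3 <= m.+1 * 'C(v, 2) by [rewrite leq_mul2l; lia]; lia.
Qed.


(** * Upper bounds in the absence of 3-simplices *)

Lemma bin2D m v : 'C(m + v, 2) = 'C(m, 2) + m * v + 'C(v, 2).
Proof.
elim: v => [|v IHv]; first by rewrite addn0 muln0 bin0n !addn0.
by rewrite addnS !binS !bin1 IHv; lia.
Qed.

Lemma free3_max_le F S B m v : F \subset powerset S -> free3 F -> S \notin F ->
  B \in F -> (forall A, A \in F -> #|A| <= #|B|) -> #|B| = m.+1 ->
  #|S| = m.+1 + v -> #|slice F B set0| <= 2 ^ m + 1 + m + 'C(m, 2) ->
  #|F| <= 2 ^ (m + v) + 1 + m + 'C(m + v, 2).
Proof.
move=> FS hF SF BF maxB cB cS F0.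
have BS : B \subset S by have := subsetP FS _ BF; rewrite inE.
have cV : #|S| - #|B| = v by rewrite cS cB; lia.
have pw : \sum_(E in powerset (S :\: B)) 2 ^ m = 2 ^ (m + v).
  by rewrite sum_nat_const card_powerset (cardsDS BS) cV mulnC -expnD.
(* The excess over [2 ^ m] per trace, sorted by [#|E|]: the hypothesis on the slice of [set0] for
   size 0, [free2_proper_le] for size 1, [free2_small_le] for size 2; from size 3 on
   [free2_smaller_le] leaves none. *)
have -> : 2 ^ (m + v) + 1 + m + 'C(m + v, 2) =
    2 ^ (m + v) + (1 + m + 'C(m, 2)) * 'C(v, 0) + m * 'C(v, 1) + 'C(v, 2).
  by rewrite bin2D bin0 bin1; lia.
rewrite (card_slices FS BS) -pw -cV -!(card_powersetD _ BS) !big_distrr /=.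
rewrite -!big_split /=.
apply: leq_sum => E; rewrite inE => /subsetDP[ES dEB].
have [->|E0] := eqVneq E set0.
  by rewrite cards0 /= muln0 muln1 !addn0 !addnA.
have E1 : 0 < #|E| by rewrite card_gt0.
have F1 := slice_free2 hF BF E0 dEB.
have sB := @slice_sub F B E.
have szC C : C \in slice F B E -> #|C| + #|E| <= #|B| by apply: slice_card FS _ _.
case cE: #|E| E1 szC => [|[|[|e]]] //= _ szC.
- rewrite muln0 muln1 !addn0; apply: free2_proper_le cB sB F1 _.
  by apply/negP => /szC; lia.
- by rewrite !muln0 !addn0; apply: free2_small_le cB sB F1 _ => C /szC.
- rewrite !muln0 !addn0; apply: free2_smaller_le cB sB F1 _ => C /szC; lia.
Qed.

Lemma free3_proper_le F S s : #|S| = s.+1 -> F \subset powerset S -> free3 F ->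
  S \notin F -> #|F| <= 2 ^ s + s + 'C(s, 2).
Proof.
elim/ltn_ind: s F S => s IH F S cS FS hF SF.
have [F1|[B [BF BS maxB] [m [v [cB cSv]]]]] := max_member FS SF.
  by apply: leq_trans F1 _; have : 0 < 2 ^ s by [rewrite expn_gt0]; lia.
have sE : s = m + v.+1 by lia.
suff F0 : #|slice F B set0| <= 2 ^ m + 1 + m + 'C(m, 2).
  by have := free3_max_le FS hF SF BF maxB cB cSv F0; rewrite -sE; lia.
pose F' := slice F B set0 :\ B.
have : #|F'| <= 2 ^ m + m + 'C(m, 2).
  apply: (IH m _ F' B) => //.
  - by rewrite sE addnS ltnS leq_addr.
  - by apply: subset_trans (slice_sub F B set0); apply: subsetDl.
  - by apply: free3_sub hF; apply: subset_trans (slice0_sub F B); apply: subsetDl.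
  - by rewrite !inE eqxx.
move=> F'm; rewrite (cardsD1 B) -/F' addnC.
by apply: leq_trans (leq_add F'm (leq_b1 _)) _; lia.
Qed.

Lemma free3_le F S s : #|S| = s.+1 -> F \subset powerset S -> free3 F ->
  #|F| <= 2 ^ s + 1 + s + 'C(s, 2).
Proof.
move=> cS FS hF; have Fs : #|F :\ S| <= 2 ^ s + s + 'C(s, 2).
  apply: (@free3_proper_le _ S) => //; last by rewrite !inE eqxx.
    exact: subset_trans (subsetDl _ _) FS.
  by apply: free3_sub hF; apply: subsetDl.
rewrite (cardsD1 S F) addnC.
by apply: leq_trans (leq_add Fs (leq_b1 _)) _; lia.
Qed.

(** The bound is [v - 1] below that of [free3_proper_le]; a family of more than one set attaining
    the latter thus has a member [B] one point short of [S]. *)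
Lemma free3_proper_max F S s : #|S| = s.+1 -> F \subset powerset S -> free3 F ->
  S \notin F -> #|F| <= 1 \/
  exists2 B, B \in F & exists m v, [/\ #|B| = m.+1, 0 < v, s = m + v &
    #|F| <= 2 ^ s + 1 + m + 'C(s, 2)].
Proof.
move=> cS FS hF SF.
have [F1|[B [BF BS maxB] [m [v [cB cSv]]]]] := max_member FS SF; first by left.
have sE : s = m + v.+1 by lia.
right; exists B => //; exists m, v.+1; split=> //.
rewrite [X in 2 ^ X]sE [X in 'C(X, 2)]sE.
apply: (free3_max_le FS hF SF BF maxB cB cSv).
apply: free3_le cB (slice_sub _ _ _) _.
by apply: free3_sub hF; apply: slice0_sub.
Qed.

(** * Size of the extremal families *)

Lemma card_star S y s : #|S| = s.+1 -> y \in S ->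
  #|[set A in powerset S | y \in A]| = 2 ^ s.
Proof.
move=> cS yS; have cSy : #|S :\ y| = s by have := cardsD1 y S; rewrite yS cS; lia.
rewrite -cSy -card_powerset.
rewrite -(card_in_imset (f := fun A => y |: A) (D := powerset (S :\ y))).
  apply: eq_card => A; rewrite !inE; apply/andP/imsetP.
    move=> [AS yA]; exists (A :\ y); last by rewrite setD1K.
    by rewrite inE setSD.
  move=> [C]; rewrite inE => /subsetD1P[CS _] ->; rewrite setU11; split=> //.
  by rewrite subUset sub1set yS.
move=> C D; rewrite !inE => /subsetD1P[_ yC] /subsetD1P[_ yD] /(congr1 (fun A => A :\ y)).
by rewrite !setU1K.
Qed.

Lemma card_small S d :
  #|[set A in powerset S | #|A| <= d]| = \sum_(i < d.+1) 'C(#|S|, i).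
Proof.
elim: d => [|d IHd]; rewrite big_ord_recr /=.
  rewrite big_ord0 bin0 add0n -(cards1 (set0 : {set T})); apply: eq_card => A.
  by rewrite !inE leqn0 cards_eq0 andb_idl // => /eqP->; apply: sub0set.
rewrite -IHd -cards_draws.
have -> : [set A in powerset S | #|A| <= d.+1] = [set A in powerset S | #|A| <= d]
    :|: [set A : {set T} | A \subset S & #|A| == d.+1].
  by apply/setP => A; rewrite !inE -andb_orr orbC -ltnS -leq_eqVlt.
rewrite cardsU (_ : _ :&: _ = set0) ?cards0 ?subn0 //.
apply/setP => A; rewrite !inE; apply/negP => /andP[/andP[_ Ad] /andP[_ /eqP e]].
by rewrite e ltnn in Ad.
Qed.

Lemma card_star_or_small S y d s : #|S| = s.+1 -> y \in S ->
  #|star_or_small S y d| = 2 ^ s + \sum_(i < d.+1) 'C(s, i).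
Proof.
move=> cS yS; have cSy : #|S :\ y| = s by have := cardsD1 y S; rewrite yS cS; lia.
rewrite -(card_star cS yS) -cSy -card_small.
have -> : star_or_small S y d =
    [set A in powerset S | y \in A] :|: [set A in powerset (S :\ y) | #|A| <= d].
  by apply/setP => A; rewrite !inE subsetD1; case: (y \in A); rewrite ?andbT ?andbF ?orbF.
rewrite cardsU (_ : _ :&: _ = set0) ?cards0 ?subn0 //.
by apply/setP => A; rewrite !inE subsetD1; case: (y \in A); rewrite ?andbF.
Qed.

Lemma card_slices1 F S z : F \subset powerset S -> z \in S ->
  #|F| = #|slice F (S :\ z) set0| + #|slice F (S :\ z) [set z]|.
Proof.
move=> FS zS; rewrite (card_slices FS (subD1set S z)).
have -> : S :\: (S :\ z) = [set z] by rewrite setDDr setDv set0U; apply/setIidPr; rewrite sub1set.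
by rewrite powerset1 big_setU1 ?big_set1 //= inE eq_sym -card_gt0 cards1.
Qed.


Lemma card_star1 S y s : #|S| = s.+1 -> y \in S ->
  #|star_or_small S y 1| = 2 ^ s + s.+1.
Proof.
move=> cS yS; rewrite (card_star_or_small _ cS yS) !big_ord_recr big_ord0 /=.
by rewrite bin0 bin1 add0n add1n.
Qed.

Lemma card_star2 S y s : #|S| = s.+1 -> y \in S ->
  #|star_or_small S y 2| = 2 ^ s + 1 + s + 'C(s, 2).
Proof.
move=> cS yS; rewrite (card_star_or_small _ cS yS) !big_ord_recr big_ord0 /=.
by rewrite bin0 bin1 !addnA addn0.
Qed.

(** * Criteria for lying in an extremal family *)

Lemma sub_star_le F S y d : F \subset powerset S -> y \in S -> #|S| <= d.+1 ->
  F \subset star_or_small S y d.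
Proof.
move=> /subsetP FS yS cS; apply/subsetP => A /FS; rewrite !inE => AS.
rewrite AS /=; case: (boolP (y \in A)) => //= yA.
have /subset_leq_card : A \subset S :\ y by rewrite subsetD1 AS.
by have := cardsD1 y S; rewrite yS; lia.
Qed.

(** [S :\ y] is the only subset of [S] that avoids [y] and has more than [d] points. *)
Lemma sub_star_missing F S y d : F \subset powerset S -> y \in S ->
  #|S| = d.+2 -> S :\ y \notin F -> F \subset star_or_small S y d.
Proof.
move=> /subsetP FS yS cS SyF; apply/subsetP => A AF; have := FS _ AF.
rewrite !inE => AS; rewrite AS /=; case: (boolP (y \in A)) => //= yA.
have ASy : A \subset S :\ y by rewrite subsetD1 AS.
rewrite leqNgt; apply: contra SyF => cA; suff <- : A = S :\ y by [].
by apply/eqP; rewrite eqEcard ASy; have := cardsD1 y S; rewrite yS; lia.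
Qed.

(** Otherwise [A], [[set y; c1]] and [[set y; c2]] form a 2-simplex: they meet pairwise in [c1],
    [c2] and [y]. *)
Lemma star1_small_only F B y c1 c2 A : free2 F -> star_or_small B y 1 \subset F ->
  y \in B -> c1 \in B -> c2 \in B -> c1 != c2 -> A \in F -> y \notin A ->
  c1 \in A -> c2 \in A -> False.
Proof.
move=> hF /subsetP sF yB c1B c2B c12 AF yA c1A c2A.
have inF c : c \in B -> [set y; c] \in F.
  by move=> cB; apply: sF; rewrite !inE subUset !sub1set yB cB eqxx.
suff /set0Pn[x] : A :&: [set y; c1] :&: [set y; c2] != set0.
  rewrite !inE => /andP[/andP[xA /orP[]/eqP xE] /orP[]/eqP xE'].
  - by rewrite xE (negPf yA) in xA.
  - by rewrite xE (negPf yA) in xA.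
  - by rewrite xE' (negPf yA) in xA.
  - by rewrite -xE -xE' eqxx in c12.
apply: hF; rewrite ?inF //; apply/set0Pn.
- by exists c1; rewrite !inE c1A eqxx orbT.
- by exists c2; rewrite !inE c2A eqxx orbT.
- by exists y; rewrite !inE eqxx.
Qed.

(** Three points [a], [b], [c] of [A :&: B] would make [A] and the sets [y] plus two of them a
    3-simplex. *)
Lemma star2_small_only F B y A : free3 F -> star_or_small B y 2 \subset F ->
  y \in B -> A \in F -> y \notin A -> #|A :&: B| <= 2.
Proof.
move=> hF /subsetP sF yB AF yA; rewrite leqNgt; apply/negP => /card_gt2P.
move=> [a [b [c [[/setIP[aA aB] /setIP[bA bB] /setIP[cA cB]] [ab bc ca]]]]].
have inF u v : u \in B -> v \in B -> [set y; u; v] \in F.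
  by move=> uB vB; apply: sF; rewrite !inE !subUset !sub1set yB uB vB eqxx.
suff /set0Pn[x] : A :&: [set y; a; b] :&: [set y; a; c] :&: [set y; b; c] != set0.
  rewrite !inE => /andP[/andP[/andP[xA]]].
  have /negPf-> /= : x != y by apply: contraNneq yA => <-.
  move=> /orP[]/eqP-> /orP[]/eqP + /orP[]/eqP; move: ab bc ca => /eqP ? /eqP ? /eqP ?; congruence.
apply: hF; rewrite ?inF //; apply/set0Pn.
- by exists a; rewrite !inE aA eqxx ?orbT.
- by exists b; rewrite !inE bA eqxx ?orbT.
- by exists c; rewrite !inE cA eqxx ?orbT.
- by exists y; rewrite !inE eqxx.
Qed.

Lemma setD1_maximal S B : B \subset S -> #|S| = #|B|.+1 ->
  exists2 z, z \in S & B = S :\ z.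
Proof.
move=> BS cS; have /eqP/cards1P[z zE] : #|S :\: B| = 1 by rewrite (cardsDS BS) cS subSnn.
exists z; first by have := set11 z; rewrite -zE inE => /andP[].
by rewrite -zE setDDr setDv set0U; apply/esym/setIidPr.
Qed.

(** The three 2-point subsets of [S] form a 2-simplex: a common point would be a fourth element of
    [S]. *)
Lemma free2_three_points F S : #|S| = 3 -> free2 F ->
  exists2 y, y \in S & S :\ y \notin F.
Proof.
move=> cS hF; case: (boolP [exists y in S, S :\ y \notin F]) => [/exists_inP//|].
move=> /exists_inPn allF; exfalso.
have inF y : y \in S -> S :\ y \in F by move=> /allF; rewrite negbK.
have /card_gt2P[a [b [c [[aS bS cS'] [ab bc ca]]]]] : 2 < #|S| by rewrite cS.
suff /set0Pn[x] : (S :\ a) :&: (S :\ b) :&: (S :\ c) != set0.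
  rewrite !inE => /andP[/andP[/andP[xa xS] /andP[xb _]] /andP[xc _]].
  have u : uniq [:: x; a; b; c].
    by rewrite /= !inE !negb_or xa xb xc ab bc (eq_sym a) ca.
  suff : size [:: x; a; b; c] <= #|S| by rewrite cS.
  rewrite -(card_uniqP u); apply/subset_leq_card/subsetP => w.
  by rewrite !inE => /or4P[]/eqP->.
apply: hF; rewrite ?inF //; apply/set0Pn.
- by exists c; rewrite !inE cS' ca eq_sym bc.
- by exists b; rewrite !inE bS bc eq_sym ab.
- by exists a; rewrite !inE aS ab eq_sym ca.
Qed.

Lemma free3_four_points F S : #|S| = 4 -> free3 F ->
  exists2 y, y \in S & S :\ y \notin F.
Proof.
move=> cS hF; case: (boolP [exists y in S, S :\ y \notin F]) => [/exists_inP//|].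
move=> /exists_inPn allF; exfalso.
have inF y : y \in S -> S :\ y \in F by move=> /allF; rewrite negbK.
have /card_gt0P[e eS] : 0 < #|S| by rewrite cS.
have /card_gt2P[a [b [c []]]] : 2 < #|S :\ e|.
  by have := cardsD1 e S; rewrite eS cS; lia.
rewrite !inE => -[/andP[ae aS] /andP[be bS] /andP[ce cS']] [ab bc ca].
suff /set0Pn[x] : (S :\ a) :&: (S :\ b) :&: (S :\ c) :&: (S :\ e) != set0.
  rewrite !inE => /andP[/andP[/andP[/andP[xa xS] /andP[xb _]] /andP[xc _]] /andP[xe _]].
  have u : uniq [:: x; a; b; c; e].
    by rewrite /= !inE !negb_or xa xb xc xe ab bc ae be ce (eq_sym a) ca.
  suff : size [:: x; a; b; c; e] <= #|S| by rewrite cS.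
  rewrite -(card_uniqP u); apply/subset_leq_card/subsetP => w.
  by rewrite !inE => /or4P[/eqP->|/eqP->|/eqP->|/orP[]/eqP->].
apply: hF; rewrite ?inF //; apply/set0Pn.
- by exists e; rewrite !inE eS !(eq_sym e) ae be ce.
- by exists c; rewrite !inE cS' ca ce eq_sym bc.
- by exists b; rewrite !inE bS bc be eq_sym ab.
- by exists a; rewrite !inE aS ab ae eq_sym ca.
Qed.

Lemma mem_slice0 F B C : C \subset B -> (C \in slice F B set0) = (C \in F).
Proof. by rewrite !inE setU0 => ->. Qed.

Lemma mem_slice1 F S z A : A \subset S -> z \in A ->
  (A :\ z \in slice F (S :\ z) [set z]) = (A \in F).
Proof. by move=> AS zA; rewrite !inE setSD //= setUC setD1K. Qed.

(** * The case of equality *)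

Lemma tight_sum a b c d : a <= c -> b <= d -> a + b = c + d -> a = c /\ b = d.
Proof. lia. Qed.

(** The summands bound the two slices along [S :\ z], by [free2_le] and [free1_le]; equality in the
    sum thus forces it in both. [free3_bound_split] does the same with [free3_le] and [free2_le]. *)
Lemma free2_bound_split s :
  2 ^ s.+1 + s.+2 = (2 ^ s + s.+1) + (2 ^ s + 1).
Proof. by rewrite expnS; lia. Qed.

Lemma free3_bound_split s :
  2 ^ s.+1 + 1 + s.+1 + 'C(s.+1, 2) =
    (2 ^ s + 1 + s + 'C(s, 2)) + (2 ^ s + s.+1).
Proof. by rewrite expnS binS bin1; lia. Qed.

Lemma free2_extremal F S s : #|S| = s.+1 -> F \subset powerset S -> free2 F ->
  #|F| = 2 ^ s + s.+1 -> exists2 y, y \in S & F = star_or_small S y 1.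
Proof.
elim: s F S => [|s IH] F S cS FS hF cF.
all: suff [y yS Fy] : exists2 y, y \in S & F \subset star_or_small S y 1 by
  [exists y => //; apply/eqP; rewrite eqEcard Fy (card_star1 cS yS) cF leqnn].
all: have /card_gt0P[y0 y0S] : 0 < #|S| by rewrite cS.
  by exists y0 => //; apply: sub_star_le; rewrite ?cS.
(* At most three points are settled directly: the argument below needs a point of [B] other than [y]
   and [c]. *)
case: s IH cS cF => [|[|s]] IH cS cF.
- by exists y0 => //; apply: sub_star_le; rewrite ?cS.
- have [y yS yF] := free2_three_points cS hF.
  by exists y => //; apply: sub_star_missing.
have F'S : F :\ S \subset powerset S by apply: subset_trans (subsetDl _ _) FS.
have hF' : free2 (F :\ S) by apply: free2_sub hF; apply: subsetDl.
have SF' : S \notin F :\ S by rewrite !inE eqxx.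
have cF' : 2 ^ s.+3 + s.+3 <= #|F :\ S|.
  by rewrite -ltnS -addnS -cF (cardsD1 S F) -add1n leq_add2r leq_b1.
have [|[B [BF' BS _] [m [v [cB v0 sE mv]]]]] := free2_proper_max cS F'S hF' SF'.
  by lia.
(* [F :\ S] has at least [2 ^ (m + v) + (m + v)] members, while [mv] allows an excess of at most
   [m.+1]. *)
have v1 : v = 1.
  case: v v0 sE mv => [|[|v]] // _ sE mv.
  have : 0 < 'C(v.+2, 2) by rewrite bin_gt0.
  by move=> ?; have : m * 1 <= m * 'C(v.+2, 2) by [rewrite leq_mul2l; lia]; lia.
have [z zS BE] : exists2 z, z \in S & B = S :\ z.
  by apply: setD1_maximal => //; rewrite cS cB; lia.
have BF : B \in F by have /setD1P[] := BF'.
have {}cB : #|B| = s.+3 by move: sE; rewrite cB v1 addn1 => ->.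
have dzB : [disjoint [set z] & B] by rewrite disjoints1 BE !inE eqxx.
have z0 : [set z] != set0 by rewrite -card_gt0 cards1.
have le0 : #|slice F B set0| <= 2 ^ s.+2 + s.+3.
  by apply: free2_le cB (slice_sub _ _ _) _; apply: free2_sub hF; apply: slice0_sub.
have free_z := slice_free1 hF BF z0 dzB.
have lez : #|slice F B [set z]| <= 2 ^ s.+2 + 1.
  exact: free1_le cB (slice_sub _ _ _) free_z.
have := card_slices1 FS zS; rewrite -BE cF free2_bound_split => /esym.
move=> /(tight_sum le0 lez)[c0 cz].
have [|y yB sE0] := IH _ _ cB (slice_sub _ _ _) _ c0.
  by apply: free2_sub hF; apply: slice0_sub.
have sF : star_or_small B y 1 \subset F by rewrite -sE0 slice0_sub.
exists y; first by move: yB; apply/subsetP.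
apply/subsetP => A AF; have := subsetP FS _ AF; rewrite !inE => AS; rewrite AS /=.
case: (boolP (y \in A)) => //= yA; rewrite leqNgt; apply/negP => A2.
case: (boolP (z \in A)) => zA; last first.
  have AB : A \subset B by rewrite BE subsetD1 AS.
  have : A \in star_or_small B y 1 by rewrite -sE0 mem_slice0.
  by rewrite !inE (negPf yA) AB leqNgt A2.
have Cz : A :\ z \in slice F B [set z] by rewrite BE mem_slice1.
have CB : A :\ z \subset B by rewrite BE setSD.
case: (leqP #|A :\ z| 1) => [C1|/card_gt1P[c1 [c2 [c1C c2C c12]]]]; last first.
  have [/setD1P[_ c1A] /setD1P[_ c2A]] := (c1C, c2C).
  exact: (star1_small_only hF sF yB (subsetP CB _ c1C) (subsetP CB _ c2C) c12 AF).
have /eqP/cards1P[c CE] : #|A :\ z| = 1.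
  by apply/eqP; rewrite eqn_leq C1 -ltnS; move: A2; rewrite (cardsD1 z A) zA.
rewrite CE in Cz CB.
have cB' : c \in B by rewrite -sub1set.
have cA : c \in A by have := set11 c; rewrite -CE => /setD1P[].
(* The case left is [A = [set z; c]]. Every nonempty member of the slice meets [[set c]], and its
   size [cz] forces all sets containing [c] to occur. *)
have sliceE : slice F B [set z] = set0 |: [set D in powerset B | c \in D].
  apply/eqP; rewrite eqEcard cz cardsU1 (card_star cB cB') !inE andbF /= addnC leqnn andbT.
  apply/subsetP => D Dz; rewrite !inE; case: eqVneq => //= D0.
  have := subsetP (slice_sub _ _ _) _ Dz; rewrite inE => -> /=.
  have /set0Pn[x] : D :&: [set c] != set0.
    by apply: free_z => //; rewrite -card_gt0 cards1.
  by rewrite !inE => /andP[xD /eqP <-].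
(* With such a point [e], the set of [c], [e] and [z] is a member avoiding [y], against
   [star1_small_only]. *)
have /card_gt0P[e] : 0 < #|B :\ y :\ c|.
  clear -yB cB.
  have := cardsD1 y B; have := cardsD1 c (B :\ y); rewrite yB cB.
  by have := leq_b1 (c \in B :\ y); lia.
rewrite !inE => /and3P[ec ey eB].
have : [set c; e] \in slice F B [set z].
  by rewrite sliceE !inE subUset !sub1set cB' eB eqxx orbT.
rewrite inE => /andP[_ ceF].
have ce : c != e by rewrite eq_sym.
apply: (star1_small_only hF sF yB cB' eB ce ceF); rewrite !inE ?eqxx ?orbT //.
rewrite !negb_or eq_sym; apply/andP; split; last first.
  by apply: contraNneq yA => ->.
by rewrite eq_sym (eq_sym y e) ey andbT; apply: contraNneq yA => ->.
Qed.

Lemma free3_extremal F S s : #|S| = s.+1 -> F \subset powerset S -> free3 F ->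
  #|F| = 2 ^ s + 1 + s + 'C(s, 2) ->
  exists2 y, y \in S & F = star_or_small S y 2.
Proof.
elim: s F S => [|s IH] F S cS FS hF cF.
all: suff [y yS Fy] : exists2 y, y \in S & F \subset star_or_small S y 2 by
  [exists y => //; apply/eqP; rewrite eqEcard Fy (card_star2 cS yS) cF leqnn].
all: have /card_gt0P[y0 y0S] : 0 < #|S| by rewrite cS.
  by exists y0 => //; apply: sub_star_le; rewrite ?cS.
(* At most four points are settled directly, so that [B :\ y] has at least three points below. *)
case: s IH cS cF => [|[|[|s]]] IH cS cF.
- by exists y0 => //; apply: sub_star_le; rewrite ?cS.
- by exists y0 => //; apply: sub_star_le; rewrite ?cS.
- have [y yS yF] := free3_four_points cS hF.
  by exists y => //; apply: sub_star_missing.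
have F'S : F :\ S \subset powerset S by apply: subset_trans (subsetDl _ _) FS.
have hF' : free3 (F :\ S) by apply: free3_sub hF; apply: subsetDl.
have SF' : S \notin F :\ S by rewrite !inE eqxx.
have cF' : 2 ^ s.+4 + s.+4 + 'C(s.+4, 2) <= #|F :\ S|.
  have -> : 2 ^ s.+4 + s.+4 + 'C(s.+4, 2) = #|F|.-1 by rewrite cF addn1.
  by rewrite (cardsD1 S F); case: (S \in F); rewrite //= add0n leq_pred.
have [|[B BF' [m [v [cB v0 sE mv]]]]] := free3_proper_max cS F'S hF' SF'.
  by lia.
have v1 : v = 1 by lia.
have BS : B \subset S by have := subsetP F'S _ BF'; rewrite inE.
have [z zS BE] : exists2 z, z \in S & B = S :\ z.
  by apply: setD1_maximal => //; rewrite cS cB; lia.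
have BF : B \in F by have /setD1P[] := BF'.
have {}cB : #|B| = s.+4 by move: sE; rewrite cB v1 addn1 => ->.
have dzB : [disjoint [set z] & B] by rewrite disjoints1 BE !inE eqxx.
have z0 : [set z] != set0 by rewrite -card_gt0 cards1.
have le0 : #|slice F B set0| <= 2 ^ s.+3 + 1 + s.+3 + 'C(s.+3, 2).
  by apply: free3_le cB (slice_sub _ _ _) _; apply: free3_sub hF; apply: slice0_sub.
have free_z := slice_free2 hF BF z0 dzB.
have lez : #|slice F B [set z]| <= 2 ^ s.+3 + s.+4.
  exact: free2_le cB (slice_sub _ _ _) free_z.
have := card_slices1 FS zS; rewrite -BE cF free3_bound_split => /esym.
move=> /(tight_sum le0 lez)[c0 cz].
have [|y yB sE0] := IH _ _ cB (slice_sub _ _ _) _ c0.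
  by apply: free3_sub hF; apply: slice0_sub.
have [y' y'B sEz] := free2_extremal cB (slice_sub _ _ _) free_z cz.
have sF : star_or_small B y 2 \subset F by rewrite -sE0 slice0_sub.
have yz : y != z by apply: contraTneq yB => ->; rewrite BE !inE eqxx.
(* The two slices have the same centre: otherwise [B :\ y] contains [y'], so adding [z] to it gives
   a member that avoids [y] and meets [B] in too many points. *)
have y'y : y' = y.
  apply/eqP/negPn/negP => y'y.
  have : B :\ y \in slice F B [set z] by rewrite sEz !inE subsetDl y'y y'B.
  rewrite inE => /andP[_ /(star2_small_only hF sF yB)].
  rewrite !inE eqxx (negPf yz) => /(_ isT).
  have -> : (B :\ y :|: [set z]) :&: B = B :\ y.
    apply/setP => x; rewrite BE !inE.
    by case: (x == z); case: (x == y); case: (x \in S).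
  by have := cardsD1 y B; rewrite yB cB add1n => -[<-].
exists y; first by move: yB; apply/subsetP.
apply/subsetP => A AF; have := subsetP FS _ AF; rewrite !inE => AS; rewrite AS /=.
case: (boolP (y \in A)) => //= yA.
case: (boolP (z \in A)) => zA; last first.
  have AB : A \subset B by rewrite BE subsetD1 AS.
  by have := star2_small_only hF sF yB AF yA; rewrite (setIidPl AB).
have : A :\ z \in star_or_small B y 1 by rewrite -y'y -sEz BE mem_slice1.
by rewrite !inE (negPf yA) andbF /= => /andP[_]; rewrite (cardsD1 z A) zA.
Qed.

End Families.

Theorem theorem4 (T : finType) (n : nat) (hn : 1 <= n) (hT : #|T| = n)
    (F : {set {set T}}) (hF : simplex_free 3 F) :
  #|F| <= 2 ^ (n - 1) + 'C(n - 1, 0) + 'C(n - 1, 1) + 'C(n - 1, 2) /\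
  (#|F| = 2 ^ (n - 1) + 'C(n - 1, 0) + 'C(n - 1, 1) + 'C(n - 1, 2) <->
   exists x : T,
     F = [set A : {set T} | x \in A]
         :|: [set A : {set T} | (A \subset [set: T] :\ x) && (#|A| <= 2)]).
Proof.
case: n hn hT => [//|s] _ hT; rewrite subSS subn0 bin0 bin1.
have cS : #|[set: T]| = s.+1 by rewrite cardsT.
have FS : F \subset powerset [set: T] by apply/subsetP => A _; rewrite inE subsetT.
have h3 := simplex_free_free3 hF.
have starE x : [set A : {set T} | x \in A]
    :|: [set A : {set T} | (A \subset [set: T] :\ x) && (#|A| <= 2)] =
    star_or_small [set: T] x 2.
  by apply/setP => A; rewrite !inE subsetD1 subsetT /=; case: (x \in A).
split; first exact: free3_le cS FS h3.
split=> [cF|[x ->]].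
  by have [x _ ->] := free3_extremal cS FS h3 cF; exists x; rewrite starE.
by rewrite starE (card_star2 cS (in_setT x)).
Qed.
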